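(* Let $(M^{2n+1},\phi,\xi,\eta,g)$ be an almost co-Kähler manifold that admits a $\beta$-almost Yamabe soliton with potential vector field $b\xi$, where $b$ is a non-zero smooth function on $M$; i.e. there are a smooth function $\beta:M\to\mathbb{R}$ and a function $\lambda:M\to\mathbb{R}$ such that $\beta\,\mathcal{L}_{b\xi}g=(\lambda-r)g$, where $r$ is the scalar curvature of $g$. Suppose that either $\beta>0$ on all of $M$ or $\beta<0$ on all of $M$. Then the soliton is trivial.
   Context: An almost contact metric structure $(\phi,\xi,\eta,g)$ on a smooth $(2n+1)$-dimensional Riemannian manifold $(M,g)$ consists of a $(1,1)$-tensor field $\phi$, a unit vector field $\xi$ (the Reeb vector field) and a $1$-form $\eta$ with $\phi^2=-I+\eta\otimes\xi$, $\eta(\xi)=1$, $\phi\xi=0$, $\eta\circ\phi=0$, and $g(\phi X,\phi Y)=g(X,Y)-\eta(X)\eta(Y)$ for all vector fields $X,Y$ (so $g(X,\xi)=\eta(X)$). Put $\Phi(X,Y)=g(X,\phi Y)$. The manifold $(M^{2n+1},\phi,\xi,\eta,g)$ is almost co-Kähler if both the $1$-form $\eta$ and the $2$-form $\Phi$ are closed. A $\beta$-almost Yamabe soliton with potential vector field $V$ is trivial if $V$ is Killing, i.e. $\mathcal{L}_{V}g=0$, where $\mathcal{L}$ denotes the Lie derivative.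
   Formalization: The formal theorem assumes n ≥ 1 (dimension at least 3); for n = 0 the claim fails, e.g. M = R, ξ = d/dt, η = dt, φ = 0, b(t) = t, β = 1, λ = 2, where the Lie derivative of g along bξ is 2g. *)

(* Defs.v *)
From HB Require Import structures.
From mathcomp Require Import all_boot all_order all_algebra.
From mathcomp Require Import all_classical all_reals all_analysis.
Import Order.TTheory GRing.Theory Num.Theory.
Import numFieldNormedType.Exports.

Set Implicit Arguments.
Unset Strict Implicit.
Unset Printing Implicit Defensive.

Local Open Scope classical_set_scope.
Local Open Scope ring_scope.

Section Smooth.
Context {R : realType} {m : nat}.
Implicit Types (U : set 'rV[R]_m) (f : 'rV[R]_m -> R).

Definition partial (i : 'I_m) f : 'rV[R]_m -> R :=
  fun x => 'D_(delta_mx 0 i) (f : 'rV[R]_m -> R^o) x.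

(* Meaningful for open U only: the derivatives are those of f as a function on
   the whole space, and at points of U they depend only on f restricted to U. *)
Fixpoint is_Ck (k : nat) U f : Prop :=
  match k with
  | 0%N => forall x, U x -> {for x, continuous f}
  | k'.+1 => (forall x, U x -> differentiable (f : 'rV[R]_m -> R^o) x) /\
             (forall i, is_Ck k' U (partial i f))
  end.

Definition smooth_on U f : Prop := forall k, is_Ck k U f.

End Smooth.

Record chart (R : realType) (m : nat) (M : topologicalType) := Chart {
  cdom : set M;
  cimg : set 'rV[R]_m;
  cmap : M -> 'rV[R]_m;
  cinv : 'rV[R]_m -> M;
  cdom_open : open cdom;
  cimg_open : open cimg;
  cmap_img : forall p, cdom p -> cimg (cmap p);
  cinv_dom : forall x, cimg x -> cdom (cinv x);
  cmapK : forall p, cdom p -> cinv (cmap p) = p;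
  cinvK : forall x, cimg x -> cmap (cinv x) = x;
  cmap_continuous : {within cdom, continuous cmap};
  cinv_continuous : {within cimg, continuous cinv} }.

Section Transition.
Context {R : realType} {m : nat} {M : topologicalType}.
Implicit Types a b : chart R m M.

Definition overlap a b : set 'rV[R]_m := cimg a `&` cinv a @^-1` cdom b.

Definition transition a b : 'rV[R]_m -> 'rV[R]_m := cmap b \o cinv a.

End Transition.

(* The smooth structure is the one generated by the given atlas, which need not
   be maximal. *)
Record smooth_manifold (R : realType) (m : nat) := SmoothManifold {
  carrier :> topologicalType;
  manifold_hausdorff : hausdorff_space carrier;
  manifold_second_countable : @second_countable carrier;
  atlas : Type;
  chart_of : atlas -> chart R m carrier;
  atlas_cover : forall p, exists a, cdom (chart_of a) p;
  atlas_compatible : forall a b k,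
    smooth_on (overlap (chart_of a) (chart_of b))
      (fun x => transition (chart_of a) (chart_of b) x 0 k) }.

Section Tensors.
Context {R : realType} {m : nat} (M : smooth_manifold R m).

Local Notation chart_at := (@chart_of R m M).

Definition smooth_function (f : M -> R) : Prop :=
  forall a, smooth_on (cimg (chart_at a)) (f \o cinv (chart_at a)).

(* A tensor field is the family of its component arrays in the charts of the
   atlas, as functions of the coordinates x; only the values for x in the image
   of the chart matter.  Tangent vectors are row vectors v of components in the
   coordinate frame, on which the other tensors act as follows:
     1-form w : 'cV            v |-> v *m w
     (1,1)-tensor F : 'M       v |-> v *m F
     (0,2)-tensor B : 'M       (v, w) |-> v *m B *m w^T. *)
Definition components (T : Type) : Type := atlas M -> 'rV[R]_m -> T.

Definition smooth_components p q (T : components 'M[R]_(p, q)) : Prop :=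
  forall a i j, smooth_on (cimg (chart_at a)) (fun x => T a x i j).

Definition changes_by (T : Type) (law : 'M[R]_m -> T -> T -> Prop)
    (t : components T) : Prop :=
  forall a b x, overlap (chart_at a) (chart_at b) x ->
    law ('J (transition (chart_at a) (chart_at b)) x)
        (t a x) (t b (transition (chart_at a) (chart_at b) x)).

(* 'J f x has entry d f_j / d x_i in row i and column j. *)
Definition vector_field (V : components 'rV[R]_m) : Prop :=
  smooth_components V /\ changes_by (fun J v v' => v' = v *m J) V.

Definition one_form (w : components 'cV[R]_m) : Prop :=
  smooth_components w /\ changes_by (fun J u u' => u = J *m u') w.

Definition tensor11 (F : components 'M[R]_m) : Prop :=
  smooth_components F /\ changes_by (fun J A A' => A *m J = J *m A') F.

Definition tensor02 (B : components 'M[R]_m) : Prop :=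
  smooth_components B /\ changes_by (fun J A A' => A = J *m A' *m J^T) B.

Definition eval1 (w : 'cV[R]_m) (v : 'rV[R]_m) : R := (v *m w) 0 0.

Definition eval2 (B : 'M[R]_m) (v w : 'rV[R]_m) : R := (v *m B *m w^T) 0 0.

Definition riemannian_metric (g : components 'M[R]_m) : Prop :=
  [/\ tensor02 g,
      forall a x, cimg (chart_at a) x ->
        forall v w, eval2 (g a x) v w = eval2 (g a x) w v
    & forall a x, cimg (chart_at a) x ->
        forall v, v != 0 -> 0 < eval2 (g a x) v v].

Definition scale_field (f : M -> R) (V : components 'rV[R]_m) :
    components 'rV[R]_m :=
  fun a x => f (cinv (chart_at a) x) *: V a x.

End Tensors.

Section LocalCalculus.
Context {R : realType} {m : nat}.
Implicit Types (g B : 'rV[R]_m -> 'M[R]_m) (V : 'rV[R]_m -> 'rV[R]_m).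
Implicit Types (w : 'rV[R]_m -> 'cV[R]_m) (x : 'rV[R]_m).

(* Exterior derivatives, evaluated on coordinate vector fields; the constant
   factors of the various conventions are irrelevant to closedness. *)
Definition ext_deriv1 w x (i j : 'I_m) : R :=
  partial i (fun y => w y j 0) x - partial j (fun y => w y i 0) x.

Definition ext_deriv2 B x (i j k : 'I_m) : R :=
  partial i (fun y => B y j k) x + partial j (fun y => B y k i) x
  + partial k (fun y => B y i j) x.

(* (L_V B)(X, Y) = V (B(X, Y)) - B([V, X], Y) - B(X, [V, Y]) for X and Y the
   i-th and j-th coordinate vector fields, where [V, X] = - sum_k (d_i V^k) d_k
   and [V, Y] = - sum_k (d_j V^k) d_k. *)
Definition lie_derivative V B x : 'M[R]_m :=
  \matrix_(i, j) \sum_k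
    (V x 0 k * partial k (fun y => B y i j) x
     + partial i (fun y => V y 0 k) x * B x k j
     + partial j (fun y => V y 0 k) x * B x i k).

(* Gamma^k_{ij} of the Levi-Civita connection *)
Definition christoffel g (k i j : 'I_m) x : R :=
  2^-1 * \sum_l invmx (g x) k l *
    (partial i (fun y => g y j l) x + partial j (fun y => g y i l) x
     - partial l (fun y => g y i j) x).

(* R(d_i, d_j) d_k = sum_l (riemann g l i j k) d_l, with the convention
   R(X, Y) Z = D_X D_Y Z - D_Y D_X Z - D_[X, Y] Z *)
Definition riemann g (l i j k : 'I_m) x : R :=
  partial i (christoffel g l j k) x - partial j (christoffel g l i k) x
  + \sum_p (christoffel g p j k x * christoffel g l i p x
            - christoffel g p i k x * christoffel g l j p x).

(* Ric(Y, Z) is the trace of X |-> R(X, Y) Z. *)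
Definition ricci g (j k : 'I_m) x : R := \sum_i riemann g i i j k x.

Definition scalar_curvature g x : R :=
  \sum_j \sum_k invmx (g x) j k * ricci g j k x.

End LocalCalculus.

Record almost_contact_metric (R : realType) (m : nat)
    (M : smooth_manifold R m) := AlmostContactMetric {
  phi : components M 'M[R]_m;
  xi : components M 'rV[R]_m;
  eta : components M 'cV[R]_m;
  metric : components M 'M[R]_m;
  phi_tensor : tensor11 phi;
  xi_field : vector_field xi;
  eta_form : one_form eta;
  metric_riemannian : riemannian_metric metric;
  xi_unit : forall a x, cimg (chart_of a) x ->
    eval2 (metric a x) (xi a x) (xi a x) = 1;
  phi_square : forall a x, cimg (chart_of a) x -> forall v,
    v *m phi a x *m phi a x = - v + eval1 (eta a x) v *: xi a x;
  eta_xi : forall a x, cimg (chart_of a) x -> eval1 (eta a x) (xi a x) = 1;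
  phi_xi : forall a x, cimg (chart_of a) x -> xi a x *m phi a x = 0;
  eta_phi : forall a x, cimg (chart_of a) x -> forall v,
    eval1 (eta a x) (v *m phi a x) = 0;
  metric_compatible : forall a x, cimg (chart_of a) x -> forall v w,
    eval2 (metric a x) (v *m phi a x) (w *m phi a x) =
    eval2 (metric a x) v w - eval1 (eta a x) v * eval1 (eta a x) w }.

Section AlmostCoKaehler.
Context {R : realType} {m : nat} {M : smooth_manifold R m}.
Implicit Type S : almost_contact_metric M.

(* eval2 (fundamental_form S a x) v w = g(v, phi w) *)
Definition fundamental_form S : components M 'M[R]_m :=
  fun a x => metric S a x *m (phi S a x)^T.

Definition almost_cokaehler S : Prop :=
  (forall a x, cimg (chart_of a) x ->
     forall i j, ext_deriv1 (eta S a) x i j = 0) /\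
  (forall a x, cimg (chart_of a) x ->
     forall i j k, ext_deriv2 (fundamental_form S a) x i j k = 0).

Definition killing (g : components M 'M[R]_m) (V : components M 'rV[R]_m) :
    Prop :=
  forall a x, cimg (chart_of a) x -> lie_derivative (V a) (g a) x = 0.

(* The soliton equation is an equation between (0,2)-tensors, stated for the
   components in every chart; the scalar curvature at cinv (chart_of a) x is
   computed in that same chart. *)
Definition almost_yamabe_soliton (g : components M 'M[R]_m)
    (beta lambda : M -> R) (V : components M 'rV[R]_m) : Prop :=
  forall a x, cimg (chart_of a) x ->
    let p := cinv (chart_of a) x in
    beta p *: lie_derivative (V a) (g a) x =
    (lambda p - scalar_curvature (g a) x) *: g a x.

End AlmostCoKaehler.

(* Main.v *)
Require Import Defs.
From mathcomp Require Import all_boot all_order all_algebra.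
From mathcomp Require Import all_classical all_reals all_analysis.
Import Order.TTheory GRing.Theory Num.Theory.
Import numFieldNormedType.Exports.

Set Implicit Arguments.
Unset Strict Implicit.
Unset Printing Implicit Defensive.

Local Open Scope classical_set_scope.
Local Open Scope ring_scope.

(** The soliton equation says that L_(b xi) g = f g with
    f = (lambda - r) / beta, so the claim is that f vanishes.  The argument is
    pointwise, in one chart.

    Write c for the differential of b.  Since eta = g(., xi),
      L_(b xi) g = b L_xi g + c (x) eta + eta (x) c,
    and two facts about the Reeb field of an almost co-Kaehler structure
    determine the rest.

    - (L_xi g)(., xi) = 0 ([lie_metric_mul_xi]).  As eta is closed and
      eta(xi) = 1, Cartan's formula gives L_xi eta = 0; contract L_xi g with xi.
    - The g-trace of L_xi g, which is twice the divergence of xi, is zero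
      ([mxtrace_lie_metric]).  As Phi is closed and annihilated by xi, Cartan's
      formula gives L_xi Phi = 0.  Expanding Phi(X, Y) = g(X, phi Y) and
      multiplying by phi once more, the trace of L_xi g is expressed through
      the trace of (L_xi phi) phi, half the derivative of tr (phi^2) = 1 - m,
      which is constant; here m is the dimension.

    Evaluating L_(b xi) g = f g on (xi, xi) gives 2 xi(b) = f; taking its
    g-trace gives 2 xi(b) = m f.  Hence (m - 1) f = 0, and m = 2n + 1 > 1.

    In coordinates everything is matrix algebra with the Leibniz rule: for
    P_ik = d_i X^k one has L_X B = D_X B + P B + B P^T. *)

(** * Calculus of matrix-valued functions and Lie derivatives *)

Section MatrixCalculus.
Context {R : realType} {m : nat}.
Implicit Types (x v : 'rV[R]_m) (f : 'rV[R]_m -> R).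

Definition mx_differentiable p q (T : 'rV[R]_m -> 'M[R]_(p, q)) x : Prop :=
  forall i j, differentiable (fun y => T y i j : R^o) x.

Definition mx_derive v p q (T : 'rV[R]_m -> 'M[R]_(p, q)) x : 'M[R]_(p, q) :=
  \matrix_(i, j) 'D_v (fun y => T y i j : R^o) x.

Definition field_jacobian (X : 'rV[R]_m -> 'rV[R]_m) x : 'M[R]_m :=
  \matrix_(i, k) partial i (fun y => X y 0 k) x.

Lemma derive_partial f x v : differentiable (f : _ -> R^o) x ->
  'D_v (f : _ -> R^o) x = \sum_k v 0 k * partial k f x.
Proof.
move=> df; rewrite deriveE // {1}(row_sum_delta v) linear_sum /=.
by apply: eq_bigr => k _; rewrite linearZ /= /partial deriveE.
Qed.

Lemma mx_differentiable_mul p q r (S : 'rV[R]_m -> 'M[R]_(p, q))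
    (T : 'rV[R]_m -> 'M[R]_(q, r)) x :
  mx_differentiable S x -> mx_differentiable T x ->
  mx_differentiable (fun y => S y *m T y) x.
Proof.
move=> dS dT i j.
rewrite (_ : (fun y => _) =
    \sum_k ((fun y => S y i k : R^o) * (fun y => T y k j : R^o))).
  by apply: differentiable_sum => k; apply: differentiableM.
by apply/funext => y; rewrite mxE fct_sumE.
Qed.

Lemma mx_differentiable_tr p q (T : 'rV[R]_m -> 'M[R]_(p, q)) x :
  mx_differentiable T x -> mx_differentiable (fun y => (T y)^T) x.
Proof.
move=> dT i j; rewrite (_ : (fun y => _) = fun y => T y j i) //.
by apply/funext => y; rewrite mxE.
Qed.

Lemma mx_derive_mul v p q r (S : 'rV[R]_m -> 'M[R]_(p, q))
    (T : 'rV[R]_m -> 'M[R]_(q, r)) x :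
  mx_differentiable S x -> mx_differentiable T x ->
  mx_derive v (fun y => S y *m T y) x =
  mx_derive v S x *m T x + S x *m mx_derive v T x.
Proof.
move=> dS dT; apply/matrixP => i j; rewrite !mxE -big_split /=.
rewrite (_ : (fun y => _) =
    \sum_k ((fun y => S y i k : R^o) * (fun y => T y k j : R^o))); last first.
  by apply/funext => y; rewrite mxE fct_sumE.
rewrite derive_sum; last first.
  by move=> k; apply: derivableM; apply: diff_derivable.
apply: eq_bigr => k _; rewrite deriveM; try exact: diff_derivable.
by rewrite !mxE [LHS]addrC; congr (_ + _); exact: mulrC.
Qed.

Lemma mx_derive_tr v p q (T : 'rV[R]_m -> 'M[R]_(p, q)) x :
  mx_derive v (fun y => (T y)^T) x = (mx_derive v T x)^T.
Proof.
apply/matrixP => i j; rewrite !mxE; congr ('D_v _ x).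
by apply/funext => y; rewrite mxE.
Qed.

Lemma mx_derive_opp v p q (T : 'rV[R]_m -> 'M[R]_(p, q)) x :
  mx_differentiable T x -> mx_derive v (fun y => - T y) x = - mx_derive v T x.
Proof.
move=> dT; apply/matrixP => i j; rewrite !mxE.
transitivity ('D_v (- (fun y => T y i j : R^o)) x).
  by congr ('D_v _ x); apply/funext => y; rewrite mxE.
by rewrite deriveN //; apply: diff_derivable.
Qed.

(** The form in which identities that hold only on the image of a chart are
    differentiated. *)
Lemma near_eq_mx_derive v p q (S T : 'rV[R]_m -> 'M[R]_(p, q)) x :
  {near x, S =1 T} -> mx_derive v S x = mx_derive v T x.
Proof.
move=> ST; apply/matrixP => i j; rewrite !mxE.
by apply: near_eq_derive; move: ST; apply: filterS => y ->.
Qed.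

Lemma mx_derive_cst v p q (C : 'M[R]_(p, q)) x :
  mx_derive v (fun=> C) x = 0.
Proof.
by apply/matrixP => i j; rewrite !mxE derive_cst.
Qed.

Lemma mx_derive_row (X : 'rV[R]_m -> 'rV[R]_m) x v : mx_differentiable X x ->
  mx_derive v X x = v *m field_jacobian X x.
Proof.
move=> dX; apply/rowP => j; rewrite !mxE derive_partial //.
by apply: eq_bigr => k _; rewrite mxE.
Qed.

Lemma mxtrace_mx_derive v p (T : 'rV[R]_m -> 'M[R]_p) x :
  mx_differentiable T x ->
  \tr (mx_derive v T x) = 'D_v (fun y => \tr (T y) : R^o) x.
Proof.
move=> dT; rewrite (_ : (fun y => _) = \sum_i (fun y => T y i i : R^o)).
  rewrite derive_sum => [|i]; last exact: diff_derivable.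
  by apply: eq_bigr => i _; rewrite mxE.
by apply/funext => y; rewrite fct_sumE.
Qed.

Lemma lie_derivativeE X B x : mx_differentiable B x ->
  lie_derivative X B x = mx_derive (X x) B x
    + field_jacobian X x *m B x + B x *m (field_jacobian X x)^T.
Proof.
move=> dB; apply/matrixP => i j; rewrite !mxE derive_partial // -!big_split /=.
by apply: eq_bigr => k _; rewrite !mxE [B x i k * _]mulrC.
Qed.

(** The Leibniz rule L_(f X) B = f L_X B + df (x) B(X, .) + B(., X) (x) df. *)
Lemma lie_derivative_scale f X B x :
    differentiable (f : _ -> R^o) x -> mx_differentiable X x ->
    mx_differentiable B x ->
  lie_derivative (fun y => f y *: X y) B x =
    f x *: lie_derivative X B x
    + (\col_i partial i f x) *m (X x *m B x)
    + (B x *m (X x)^T) *m (\col_i partial i f x)^T.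
Proof.
move=> df dX dB; set c := \col_i _.
have jac_fX : field_jacobian (fun y => f y *: X y) x =
    c *m X x + f x *: field_jacobian X x.
  apply/matrixP => i k; rewrite !mxE /partial big_ord1 !mxE.
  rewrite (_ : (fun y => _) = (f : _ -> R^o) * (fun y => X y 0 k : R^o)).
    rewrite deriveM; try exact: diff_derivable.
    by rewrite [LHS]addrC; congr (_ + _); exact: mulrC.
  by apply/funext => y; rewrite !mxE.
have dfX : mx_differentiable (fun y => f y *: X y) x.
  move=> i k; rewrite (_ : (fun y => _) =
      (f : _ -> R^o) * (fun y => X y i k : R^o)); first exact: differentiableM.
  by apply/funext => y; rewrite mxE.
have der_scale : mx_derive (f x *: X x) B x = f x *: mx_derive (X x) B x.
  by apply/matrixP => i j; rewrite !mxE !deriveE // linearZ.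
rewrite !lie_derivativeE // jac_fX der_scale linearD /= linearZ /= trmx_mul.
rewrite mulmxDl mulmxDr !scalerDr -!scalemxAl -!scalemxAr !mulmxA.
rewrite -!addrA; congr (_ + _); rewrite addrCA; congr (_ + _).
by rewrite [LHS]addrA [LHS]addrC.
Qed.

(** Cartan's formula L_X w = d(w(X)) + i_X dw, whose right-hand side vanishes
    when w is closed and w(X) is constant.  The left-hand side of the
    conclusion is L_X w in coordinates. *)
Lemma lie_derivative_closed_one_form X w x :
    mx_differentiable X x -> mx_differentiable w x ->
    {near x, (fun y => X y *m w y) =1 (fun=> 1%:M)} ->
    (forall i j, ext_deriv1 w x i j = 0) ->
  mx_derive (X x) w x + field_jacobian X x *m w x = 0.
Proof.
move=> dX dw Xw closed; apply/colP => i.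
have : mx_derive (delta_mx 0 i) (fun y => X y *m w y) x = 0.
  by rewrite (near_eq_mx_derive _ Xw) mx_derive_cst.
rewrite mx_derive_mul // => /matrixP /(_ 0 0); rewrite !mxE => dXw.
rewrite -[RHS]dXw [LHS]addrC; congr (_ + _).
  by apply: eq_bigr => k _; rewrite !mxE.
rewrite derive_partial //; apply: eq_bigr => k _; rewrite !mxE; congr (_ * _).
by apply/eqP; rewrite -subr_eq0 -/(ext_deriv1 w x k i) closed.
Qed.

(** Cartan's formula L_X B = d(i_X B) + i_X dB for 2-forms.  Differentiating
    i_X B = 0 turns the terms of L_X B that contain derivatives of X into
    derivatives of B, and X contracted with dB remains. *)
Lemma lie_derivative_closed_two_form X B x :
    mx_differentiable X x -> mx_differentiable B x ->
    {near x, (fun y => (B y)^T) =1 (fun y => - B y)} ->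
    {near x, (fun y => X y *m B y) =1 (fun=> 0)} ->
    (forall i j k, ext_deriv2 B x i j k = 0) ->
  lie_derivative X B x = 0.
Proof.
move=> dX dB antisymB XB closed.
have antiB : forall i j, B x i j = - B x j i.
  move=> i j; have /matrixP /(_ j i) := nbhs_singleton antisymB.
  by rewrite !mxE.
have antidB k i j :
    partial k (fun y => B y i j) x = - partial k (fun y => B y j i) x.
  have : mx_derive (delta_mx 0 k) (fun y => (B y)^T) x =
      mx_derive (delta_mx 0 k) (fun y => - B y) x by exact: near_eq_mx_derive.
  by rewrite mx_derive_tr mx_derive_opp // => /matrixP /(_ j i); rewrite !mxE.
have dXB i j : \sum_k (partial i (fun y => X y 0 k) x * B x k j) =
    - \sum_k (X x 0 k * partial i (fun y => B y k j) x).
  have : mx_derive (delta_mx 0 i) (fun y => X y *m B y) x = 0.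
    by rewrite (near_eq_mx_derive _ XB) mx_derive_cst.
  rewrite mx_derive_mul // => /matrixP /(_ 0 j); rewrite !mxE => /eqP.
  rewrite addr_eq0 => /eqP E.
  transitivity (\sum_k (mx_derive (delta_mx 0 i) X x) 0 k * B x k j).
    by apply: eq_bigr => k _; rewrite mxE.
  by rewrite E; congr (- _); apply: eq_bigr => k _; rewrite mxE.
apply/matrixP => i j; rewrite !mxE !big_split /= dXB.
have -> : \sum_k partial j (fun y => X y 0 k) x * B x i k =
    \sum_k (X x 0 k * partial j (fun y => B y k i) x).
  rewrite -[RHS]opprK -dXB -sumrN; apply: eq_bigr => k _.
  by rewrite [B x i k]antiB mulrN.
rewrite -sumrN -!big_split big1 //= => k _.
rewrite -mulrN -!mulrDr [partial i _ _]antidB opprK.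
by rewrite -/(ext_deriv2 B x k i j) closed mulr0.
Qed.

End MatrixCalculus.

(** * The almost contact identities as matrix identities *)

Lemma eval2_inj (R : realType) m (A B : 'M[R]_m) :
  (forall v w, eval2 A v w = eval2 B v w) -> A = B.
Proof.
move=> AB; apply/matrixP => i j.
have := AB (delta_mx 0 i) (delta_mx 0 j).
by rewrite /eval2 trmx_delta -!rowE -!colE !mxE.
Qed.

Section PointwiseAlmostContact.
Context {R : realType} {m : nat} {M : smooth_manifold R m}.
Variables (S : almost_contact_metric M) (a : atlas M) (x : 'rV[R]_m).
Hypothesis xa : cimg (chart_of a) x.

Local Notation F := (phi S a x).
Local Notation X := (xi S a x).
Local Notation E := (eta S a x).
Local Notation G := (metric S a x).

Lemma xi_eta_mul : X *m E = 1%:M.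
Proof. by rewrite [LHS]mx11_scalar; congr (_%:M); exact: eta_xi. Qed.

Lemma phi_mul_phi : F *m F = - 1%:M + E *m X.
Proof.
apply/row_matrixP => i; rewrite !rowE mulmxA phi_square //.
rewrite mulmxDr mulmxN mulmx1 mulmxA; congr (_ + _).
by rewrite -mul_scalar_mx -mx11_scalar.
Qed.

Lemma phi_mul_eta : F *m E = 0.
Proof.
apply/row_matrixP => i; rewrite !rowE mulmx0 mulmxA [LHS]mx11_scalar.
by rewrite -/(eval1 _ _) eta_phi // raddf0.
Qed.

Lemma metric_symmetric : G^T = G.
Proof.
have [_ sym _] := metric_riemannian S.
apply: eval2_inj => v w; rewrite -[RHS]sym // /eval2 -[RHS]trace_mx11.
by rewrite -mxtrace_tr !trmx_mul trmxK mulmxA trace_mx11.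
Qed.

Lemma metric_unitmx : G \in unitmx.
Proof.
have [_ _ pos] := metric_riemannian S.
rewrite -row_free_unit -kermx_eq0; apply/eqP/row_matrixP => i; rewrite row0.
apply/eqP; apply: contraT => /(pos _ _ xa); rewrite /eval2.
by rewrite -row_mul mulmx_ker row0 mul0mx mxE ltxx.
Qed.

Lemma phi_metric_phi : F *m G *m F^T = G - E *m E^T.
Proof.
apply: eval2_inj => v w; have := metric_compatible S xa v w.
rewrite /eval2 trmx_mul !mulmxA => ->; rewrite mulmxBr mulmxBl.
have -> : v *m (E *m E^T) *m w^T = (v *m E) *m (w *m E)^T.
  by rewrite trmx_mul !mulmxA.
rewrite [RHS]mxE; congr (_ + _); rewrite [RHS]mxE; congr (- _).
by rewrite [RHS]mxE big_ord1 [_^T 0 0]mxE.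
Qed.

(** eta is the metric dual of xi: put w = xi in the compatibility condition,
    whose left-hand side then vanishes. *)
Lemma metric_mul_xi : G *m X^T = E.
Proof.
have := congr1 (mulmx^~ X^T) phi_metric_phi.
rewrite -mulmxA -trmx_mul phi_xi // trmx0 mulmx0 mulmxBl -mulmxA -trmx_mul.
by rewrite xi_eta_mul trmx1 mulmx1 => /esym/eqP; rewrite subr_eq0 => /eqP.
Qed.

Lemma xi_mul_metric : X *m G = E^T.
Proof. by rewrite -metric_mul_xi trmx_mul trmxK metric_symmetric. Qed.

(** Replacing v by phi v in the compatibility condition gives
    g(phi^2 v, phi w) = g(phi v, w), and phi^2 v differs from - v by a multiple
    of xi, which is orthogonal to phi w. *)
Lemma fundamental_form_antisymmetric :
  (fundamental_form S a x)^T = - fundamental_form S a x.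
Proof.
rewrite /fundamental_form trmx_mul trmxK metric_symmetric.
have := congr1 (mulmx F) phi_metric_phi.
rewrite !mulmxA phi_mul_phi mulmxBr mulmxA phi_mul_eta mul0mx subr0 => <-.
rewrite mulmxDl mulmxDl mulNmx mul1mx mulNmx.
by rewrite -[E *m X *m G]mulmxA xi_mul_metric -mulmxA -trmx_mul phi_mul_eta
  trmx0 mulmx0 addr0.
Qed.

Lemma xi_mul_fundamental_form : X *m fundamental_form S a x = 0.
Proof.
by rewrite /fundamental_form mulmxA xi_mul_metric -trmx_mul phi_mul_eta trmx0.
Qed.

Lemma mxtrace_phi_square : \tr (F *m F) = 1 - m%:R.
Proof.
rewrite phi_mul_phi linearD linearN /= mxtrace_mulC xi_eta_mul.
by rewrite !mxtrace1 addrC.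
Qed.

End PointwiseAlmostContact.

(** * The Reeb field of an almost co-Kaehler structure *)

Section AlmostCoKaehlerReeb.
Context {R : realType} {m : nat} {M : smooth_manifold R m}.
Variables (S : almost_contact_metric M).
Hypothesis hS : almost_cokaehler S.
Variables (a : atlas M) (x : 'rV[R]_m).
Hypothesis xa : cimg (chart_of a) x.

Lemma near_chart (P : 'rV[R]_m -> Prop) :
  (forall y, cimg (chart_of a) y -> P y) -> \forall y \near x, P y.
Proof.
move=> allP; apply: (filterS allP).
by apply: open_nbhs_nbhs; split; first exact: cimg_open.
Qed.

Lemma smooth_components_differentiable p q (T : components M 'M[R]_(p, q)) :
  smooth_components T -> mx_differentiable (T a) x.
Proof. by move=> smT i j; have [+ _] := smT a i j 1%N; apply. Qed.

Lemma phi_differentiable : mx_differentiable (phi S a) x.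
Proof. by have [/smooth_components_differentiable] := phi_tensor S. Qed.

Lemma xi_differentiable : mx_differentiable (xi S a) x.
Proof. by have [/smooth_components_differentiable] := xi_field S. Qed.

Lemma eta_differentiable : mx_differentiable (eta S a) x.
Proof. by have [/smooth_components_differentiable] := eta_form S. Qed.

Lemma metric_differentiable : mx_differentiable (metric S a) x.
Proof.
by have [[/smooth_components_differentiable]] := metric_riemannian S.
Qed.

Local Notation LG := (lie_derivative (xi S a) (metric S a) x).

(** Contracting L_xi g with xi gives L_xi eta, because eta = g(., xi) and
    L_xi xi = 0. *)
Lemma lie_metric_mul_xi : LG *m (xi S a x)^T = 0.
Proof.
have eta0 := lie_derivative_closed_one_form xi_differentiable eta_differentiable
  (near_chart (@xi_eta_mul _ _ _ S a)) (hS.1 a x xa).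
have dGX : mx_derive (xi S a x) (eta S a) x =
    mx_derive (xi S a x) (metric S a) x *m (xi S a x)^T
    + metric S a x *m (xi S a x *m field_jacobian (xi S a) x)^T.
  rewrite -mx_derive_row; last exact: xi_differentiable.
  rewrite -mx_derive_tr -mx_derive_mul; last 2 first.
  - exact: metric_differentiable.
  - exact/mx_differentiable_tr/xi_differentiable.
  apply: near_eq_mx_derive; apply: near_chart => y ya.
  by rewrite metric_mul_xi.
rewrite lie_derivativeE; last exact: metric_differentiable.
rewrite !mulmxDl -[_ *m metric S a x *m _]mulmxA metric_mul_xi // addrAC.
by rewrite -mulmxA -trmx_mul -dGX.
Qed.

Lemma lie_fundamental_form :
  lie_derivative (xi S a) (fundamental_form S a) x = 0.
Proof.
apply: lie_derivative_closed_two_form (hS.2 a x xa).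
- exact: xi_differentiable.
- apply: mx_differentiable_mul; first exact: metric_differentiable.
  exact/mx_differentiable_tr/phi_differentiable.
- exact: near_chart (@fundamental_form_antisymmetric _ _ _ S a).
- exact: near_chart (@xi_mul_fundamental_form _ _ _ S a).
Qed.

(** Twice this trace is the derivative of tr (phi^2), which is constant. *)
Lemma mxtrace_phi_derive v : \tr (mx_derive v (phi S a) x *m phi S a x) = 0.
Proof.
have dF := phi_differentiable.
have : \tr (mx_derive v (fun y => phi S a y *m phi S a y) x) = 0.
  rewrite mxtrace_mx_derive; last exact: mx_differentiable_mul.
  transitivity ('D_v (cst (1 - m%:R) : 'rV[R]_m -> R^o) x).
    apply: near_eq_derive; apply: near_chart => y ya.
    exact: mxtrace_phi_square.
  by rewrite derive_cst.
rewrite mx_derive_mul // linearD /= [X in _ + X]mxtrace_mulC -mulr2n.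
by move=> /eqP; rewrite mulrn_eq0 => /eqP.
Qed.

(** This is div xi = 0 up to a factor 2.  Solving L_xi Phi = 0 for (L_xi g) phi
    and multiplying by phi, the terms with the Jacobian of xi cancel under the
    trace, and phi^2 = - 1 + eta (x) xi recovers the trace of L_xi g because
    L_xi g annihilates xi. *)
Lemma mxtrace_lie_metric : \tr (invmx (metric S a x) *m LG) = 0.
Proof.
set G := metric S a x; set F := phi S a x; set X := xi S a x.
set P := field_jacobian (xi S a) x; set dF := mx_derive X (phi S a) x.
have LPhi : LG *m F^T = G *m (P^T *m F^T - dF^T - F^T *m P^T).
  have := lie_fundamental_form; rewrite lie_derivativeE; last first.
    apply: mx_differentiable_mul; first exact: metric_differentiable.
    exact/mx_differentiable_tr/phi_differentiable.
  rewrite /fundamental_form mx_derive_mul; last 2 first.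
  - exact: metric_differentiable.
  - exact/mx_differentiable_tr/phi_differentiable.
  rewrite mx_derive_tr lie_derivativeE; last exact: metric_differentiable.
  rewrite -/G -/F -/X -/P -/dF !mulmxDl !mulmxBr !mulmxA => /eqP.
  rewrite -!addrA addr_eq0 => /eqP ->.
  rewrite !opprD [- (P *m G *m F^T) + _]addrC !addrA subrK.
  by rewrite [LHS]addrC addrA.
have LF : invmx G *m LG *m F^T = P^T *m F^T - dF^T - F^T *m P^T.
  by rewrite -mulmxA LPhi mulKmx //; exact: metric_unitmx.
have : \tr (invmx G *m LG *m F^T *m F^T) = 0.
  rewrite LF !mulmxBl !linearB /= -[_ *m P^T *m _]mulmxA.
  rewrite [X in _ - _ - X]mxtrace_mulC addrAC subrr sub0r -trmx_mul.
  by rewrite mxtrace_tr mxtrace_mulC mxtrace_phi_derive oppr0.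
rewrite -mulmxA -trmx_mul phi_mul_phi // linearD /= linearN /= trmx1 trmx_mul.
rewrite mulmxDr mulmxN mulmx1 mulmxA -[_ *m LG *m _]mulmxA lie_metric_mul_xi.
by rewrite mulmx0 mul0mx addr0 linearN /= => /eqP; rewrite oppr_eq0 => /eqP.
Qed.

End AlmostCoKaehlerReeb.

(** * Triviality of the soliton *)

Theorem theorem3p3 (R : realType) (n : nat) (hn : (0 < n)%N)
    (M : smooth_manifold R (2 * n + 1)%N) (S : almost_contact_metric M)
    (hS : almost_cokaehler S)
    (b : M -> R) (b_smooth : smooth_function b) (b_neq0 : exists p, b p != 0)
    (beta lambda : M -> R) (beta_smooth : smooth_function beta)
    (hsol : almost_yamabe_soliton (metric S) beta lambda
              (scale_field b (xi S)))
    (beta_sign : (forall p, 0 < beta p) \/ (forall p, beta p < 0)) :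
  killing (metric S) (scale_field b (xi S)).
Proof.
move=> a x xa; have /= sol := hsol a x xa.
set p := cinv (chart_of a) x in sol.
have beta0 : beta p != 0.
  by case: beta_sign => /(_ p) ?; [rewrite gt_eqF|rewrite lt_eqF].
move: sol; set L := lie_derivative _ _ x => sol.
set G := metric S a x in sol *.
pose f := (beta p)^-1 * (lambda p - scalar_curvature (metric S a) x).
have Lf : L = f *: G by rewrite -scalerA -sol scalerA mulVf // scale1r.
suff f0 : f = 0 by rewrite Lf f0 scale0r.
pose c := \col_i partial i (b \o cinv (chart_of a)) x.
set X := xi S a x; set E := eta S a x.
have Lb : L = b p *: lie_derivative (xi S a) (metric S a) x
    + c *m E^T + E *m c^T.
  rewrite /L lie_derivative_scale; first last.
  - exact: metric_differentiable.
  - exact: xi_differentiable.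
  - by have [+ _] := b_smooth a 1%N; apply.
  by rewrite xi_mul_metric // metric_mul_xi.
have XE : X *m E = 1%:M by exact: xi_eta_mul.
have EX : E^T *m X^T = 1%:M by rewrite -trmx_mul XE trmx1.
(* Evaluation on (xi, xi): the trace of a 1 x 1 matrix reads off its entry. *)
have trXc : \tr (X *m c) = f / 2.
  have := congr1 (fun A => \tr (X *m (A *m X^T))) Lb.
  rewrite Lf !mulmxDl -!scalemxAl lie_metric_mul_xi // scaler0 add0r.
  rewrite metric_mul_xi // -scalemxAr XE -mulmxA EX mulmx1 mulmxDr !mulmxA XE.
  rewrite mul1mx -trmx_mul linearD linearZ /= mxtrace_tr mxtrace1 mulr1 => ->.
  by rewrite -mulr2n -[_ *+ 2]mulr_natr mulfK // pnatr_eq0.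
have := congr1 (fun A => \tr (invmx G *m A)) Lb.
have GE : invmx G *m E = X^T.
  by rewrite /E -(metric_mul_xi S xa) mulKmx //; exact: metric_unitmx.
have EG : E^T *m invmx G = X.
  by rewrite /E -(xi_mul_metric S xa) mulmxK //; exact: metric_unitmx.
rewrite Lf -scalemxAr mulVmx ?metric_unitmx // !mulmxDr -scalemxAr.
rewrite !linearD !linearZ /= mxtrace_lie_metric // mulr0 add0r mxtrace1.
rewrite mxtrace_mulC -mulmxA EG mxtrace_mulC trXc mulmxA GE -trmx_mul.
rewrite mxtrace_tr mxtrace_mulC trXc -splitr => /eqP.
rewrite -subr_eq0 -{2}[f]mulr1 -mulrBr mulf_eq0 => /orP[/eqP //|].
by rewrite natrD addrK pnatr_eq0 muln_eq0 /= eqn0Ngt hn.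
Qed.
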